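(* For every integer $d \geq 1$ there exist $2^{d-1}+1$ distinct points in $\mathbb{R}^d$ such that any three (distinct) of them form an acute triangle.
   Context: $\mathbb{R}^d$ carries the standard Euclidean structure. Three distinct points form an acute triangle if each of the three angles they determine is strictly less than $\pi/2$. *)

(* Defs.v *)
From mathcomp Require Import all_boot all_order all_algebra.
From mathcomp Require Import reals trigo.

Set Implicit Arguments.
Unset Strict Implicit.
Unset Printing Implicit Defensive.

Import Order.TTheory GRing.Theory Num.Theory.
Local Open Scope ring_scope.

Definition dotp (R : realType) (d : nat) (u v : 'rV[R]_d) : R :=
  \sum_(i < d) u 0 i * v 0 i.

(* The norm `|u| that the library puts on 'rV[R]_d is the sup norm, so the
   Euclidean norm is introduced separately. *)
Definition enorm (R : realType) (d : nat) (u : 'rV[R]_d) : R :=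
  Num.sqrt (dotp u u).

(* The angle at the vertex y between the rays towards x and z. Since t / 0 = 0
   it is acos 0 = pi / 2 when x = y or z = y; only x, z != y is meaningful. *)
Definition angle (R : realType) (d : nat) (x y z : 'rV[R]_d) : R :=
  acos (dotp (x - y) (z - y) / (enorm (x - y) * enorm (z - y))).

(* Degenerate triples are excluded: three distinct collinear points have an
   angle pi, and triples with a repetition have an angle pi / 2. *)
Definition acute_triangle (R : realType) (d : nat) (x y z : 'rV[R]_d) : Prop :=
  [/\ angle y x z < pi / 2, angle x y z < pi / 2 & angle x z y < pi / 2].

(* Main.v *)
(* Write n = d - 1 and take x_k = ((1 - t_k^2) s_k, h t_k) for 0 <= k <= 2^n,
   where t_k = (2 h^2)^(-k), h = n + 3, and s_1, ..., s_(2^n) are the sign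
   vectors in {-1, 1}^n: the vertices of a cube, shrunk radially by t_k^2 and
   lifted by h t_k, together with an apex x_0 = (0, h). In the inner product of
   x_i - x_j and x_k - x_j each of the n cube coordinates contributes at least
   - 2 t_j^2, while the lift contributes h^2 (t_i - t_j) (t_k - t_j). Since the
   t's are widely separated, the lift wins when t_j is the largest or the
   smallest of the three. If t_i < t_j < t_k the lift is only about
   - h^2 t_j t_k, and a coordinate in which s_i and s_j differ contributes at
   least t_k^2 - t_j^2, which wins. So all these inner products are positive. *)
Require Import Defs.
From mathcomp Require Import all_boot all_order all_algebra.
From mathcomp Require Import reals trigo.
From mathcomp Require Import ring lra zify.

Set Implicit Arguments.
Unset Strict Implicit.
Unset Printing Implicit Defensive.

Import Order.TTheory GRing.Theory Num.Theory.

Local Open Scope ring_scope.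

(** * Acute angles from positive inner products *)

Lemma acos_lt_pihalf (R : realType) (x : R) : 0 < x <= 1 -> acos x < pi / 2.
Proof.
move=> /andP[x0 x1].
have xI : -1 <= x <= 1 by apply/andP; split=> //; lra.
have [/andP[a0 api] cosa] := acos_def xI.
have pi0 := pi_gt0 R.
rewrite -ltr_cos ?in_itv /= ?cosa ?cos_pihalf ?a0 ?api //.
by apply/andP; split; lra.
Qed.

Lemma dotpC (R : realType) (d : nat) (u v : 'rV[R]_d) : dotp u v = dotp v u.
Proof. by apply: eq_bigr => i _; rewrite mulrC. Qed.

Lemma dotp_ge0 (R : realType) (d : nat) (u : 'rV[R]_d) : 0 <= dotp u u.
Proof. by apply: sumr_ge0 => i _; rewrite -expr2 sqr_ge0. Qed.

Lemma dotp_lincomb (R : realType) (d : nat) (a b : R) (u v : 'rV[R]_d) :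
  dotp (a *: u - b *: v) (a *: u - b *: v) =
  a ^+ 2 * dotp u u - 2 * a * b * dotp u v + b ^+ 2 * dotp v v.
Proof.
rewrite /dotp !mulr_sumr -sumrN -!big_split /=.
by apply: eq_bigr => i _; rewrite !mxE; ring.
Qed.

Lemma dotp_gt0_norm (R : realType) (d : nat) (u v : 'rV[R]_d) :
  0 < dotp u v -> 0 < enorm u.
Proof.
move=> uv; rewrite /enorm sqrtr_gt0 lt_neqAle dotp_ge0 andbT eq_sym.
apply/negP => /eqP uu0.
have vv := dotp_ge0 v.
(* If [dotp u u = 0], this choice gives [a *: u - dotp u v *: v] a negative square. *)
pose a := dotp v v + 1.
have := dotp_ge0 (a *: u - dotp u v *: v).
rewrite dotp_lincomb uu0 leNgt => /negP; apply.
rewrite [X in X < _](_ : _ = - (dotp u v ^+ 2 * (dotp v v + 2))); last first.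
  by rewrite /a; ring.
by rewrite oppr_lt0 mulr_gt0 ?exprn_gt0 //; lra.
Qed.

Lemma angle_lt_pihalf (R : realType) (d : nat) (x y z : 'rV[R]_d) :
  0 < dotp (x - y) (z - y) -> angle x y z < pi / 2.
Proof.
rewrite /angle; move: (x - y) (z - y) => u v uv.
have nu := dotp_gt0_norm uv.
have nv : 0 < enorm v by apply: (@dotp_gt0_norm _ _ _ u); rewrite dotpC.
apply: acos_lt_pihalf; rewrite divr_gt0 ?mulr_gt0 //=.
rewrite ler_pdivrMr ?mulr_gt0 // mul1r.
(* Cauchy-Schwarz, from the square of |v| u - |u| v. *)
have := dotp_ge0 (enorm v *: u - enorm u *: v).
rewrite dotp_lincomb -[dotp u u]sqr_sqrtr ?dotp_ge0 //.
rewrite -[dotp v v]sqr_sqrtr ?dotp_ge0 // -/(enorm u) -/(enorm v).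
rewrite [X in _ <= X -> _](_ : _ =
  (2 * (enorm u * enorm v)) * (enorm u * enorm v - dotp u v)); last by ring.
by rewrite pmulr_rge0 ?mulr_gt0 // subr_ge0.
Qed.

(** * Contributions of the cube coordinates *)

Lemma coord_ge (R : realFieldType) (p q r : R) (a b c : bool) :
  0 <= p <= 1 -> 0 <= q <= 1 -> 0 <= r <= 1 ->
  - (2 * q) <= ((1 - p) * (-1) ^+ a - (1 - q) * (-1) ^+ b) *
               ((1 - r) * (-1) ^+ c - (1 - q) * (-1) ^+ b).
Proof.
move=> /andP[p0 p1] /andP[q0 q1] /andP[r0 r1].
(* The worst case has exactly one of [a], [c] equal to [b]. If it is [a], the product is
   [- (q - p) * (2 - r - q)], where [q - p <= q] and [0 <= 2 - r - q <= 2]. *)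
by case: a; case: b; case: c; rewrite ?expr1 ?expr0; nra.
Qed.

(** Opposite signs make the first factor [2 - p - q >= 1] in absolute value. The second factor
    contributes [r - q] if [c = b], and otherwise [2 - r - q], which is no smaller because
    [r <= 1]. *)
Lemma coord_neq_ge (R : realFieldType) (p q r : R) (a b c : bool) :
  0 <= p -> p <= q -> q <= r -> r <= 1 -> q <= 2^-1 -> a != b ->
  r - q <= ((1 - p) * (-1) ^+ a - (1 - q) * (-1) ^+ b) *
           ((1 - r) * (-1) ^+ c - (1 - q) * (-1) ^+ b).
Proof.
move=> p0 pq qr r1 q2.
by case: a; case: b => // _; case: c; rewrite ?expr1 ?expr0; nra.
Qed.

Lemma sum_ge_card (R : realFieldType) (n : nat) (P : pred 'I_n)
    (F : 'I_n -> R) (q : R) :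
  0 <= q -> (forall l, - (2 * q) <= F l) ->
  - (2 * n%:R * q) <= \sum_(l < n | P l) F l.
Proof.
move=> q0 qF; rewrite big_mkcond /=.
apply: (@le_trans _ _ (\sum_(l < n) - (2 * q))).
  by rewrite sumr_const card_ord -mulr_natl; lra.
by apply: ler_sum => l _; case: (P l); rewrite ?qF // oppr_le0 mulr_ge0.
Qed.

(** * The points and the separation of their scales *)

Definition height (R : realType) (n : nat) : R := (n + 3)%:R.

Definition scale (R : realType) (n k : nat) : R :=
  (2 * height R n ^+ 2)^-1 ^+ k.

(* Encodes a sign vector by its set of negative coordinates. Only 1 <= k <= 2 ^ n
   matters: acute_point R n 0 has factor 1 - scale R n 0 ^+ 2 = 0. *)
Definition cube_vertex (n k : nat) : {set 'I_n} :=
  nth set0 (enum {set 'I_n}) k.-1.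

Definition acute_point (R : realType) (n k : nat) : 'rV[R]_n.+1 :=
  \row_i (if unlift ord0 i is Some j
          then (1 - scale R n k ^+ 2) * (-1) ^+ (j \in cube_vertex n k)
          else height R n * scale R n k).

Lemma height_ge3 (R : realType) (n : nat) : 3 <= height R n.
Proof. by rewrite /height ler_nat leq_addl. Qed.

(** The 8 comes from weighing a lift of at least [h^2 t_j^2 / 4] against a loss of at most
    [2 n t_j^2] in the cube coordinates. *)
Lemma height_sqr_gt (R : realType) (n : nat) : 8 * n%:R < height R n ^+ 2.
Proof.
rewrite /height natrD; have : 0 <= n%:R :> R by [].
by move: (n%:R) => x x0; nra.
Qed.

Lemma scale_gt0 (R : realType) (n k : nat) : 0 < scale R n k.
Proof. by have := height_ge3 R n => h; rewrite exprn_gt0 // invr_gt0; nra. Qed.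

Lemma scale_ratio (R : realType) (n : nat) :
  0 < (2 * height R n ^+ 2)^-1 <= 18^-1.
Proof.
have h := height_ge3 R n.
have h2 : 18 <= 2 * height R n ^+ 2 by nra.
by rewrite invr_gt0 lef_pV2 ?posrE ?h2 ?andbT //; lra.
Qed.

Lemma scale_le (R : realType) (n j k : nat) :
  (j < k)%N -> 2 * height R n ^+ 2 * scale R n k <= scale R n j.
Proof.
move=> jk; have /andP[d0 d1] := scale_ratio R n.
have h := height_ge3 R n.
rewrite -ler_pdivlMl; last by nra.
rewrite /scale -exprS; apply: ler_wiXn2l => //; lra.
Qed.

Lemma scale_le1 (R : realType) (n k : nat) : scale R n k <= 1.
Proof.
by have /andP[d0 d1] := scale_ratio R n; rewrite exprn_ile1 //; lra.
Qed.

Lemma scale_le_half (R : realType) (n j k : nat) :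
  (j < k)%N -> 2 * scale R n k <= scale R n j.
Proof.
move=> jk; have := scale_le R n jk; have := scale_gt0 R n k.
by have := height_ge3 R n; nra.
Qed.

(** The lifted coordinate alone separates the points, since the scales strictly decrease. *)
Lemma acute_point_inj (R : realType) (n : nat) : injective (acute_point R n).
Proof.
move=> j k /rowP/(_ ord0); rewrite !mxE unlift_none.
have h := height_ge3 R n.
have /mulfI hI : height R n != 0 by rewrite gt_eqF //; lra.
move/hI => e; case: (ltngtP j k) => // jk; exfalso.
  by have := scale_le_half R n jk; have := scale_gt0 R n k; lra.
by have := scale_le_half R n jk; have := scale_gt0 R n j; lra.
Qed.

Lemma cube_vertex_neq (n j k : nat) :
  (0 < j)%N -> (j < k)%N -> (k <= 2 ^ n)%N ->
  cube_vertex n j != cube_vertex n k.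
Proof.
case: j => // j _; case: k => // k jk kn.
have sz : size (enum {set 'I_n}) = (2 ^ n)%N.
  have <- : #|powerset [set: 'I_n]| = (2 ^ n)%N.
    by rewrite card_powerset cardsT card_ord.
  by rewrite -cardE; apply: eq_card => A; rewrite !inE subsetT.
by rewrite /cube_vertex nth_uniq ?enum_uniq ?sz //=; lia.
Qed.

(** * Positivity of the inner products *)

Lemma dotp_acute_point (R : realType) (n i j k : nat) :
  dotp (acute_point R n i - acute_point R n j)
       (acute_point R n k - acute_point R n j) =
  height R n ^+ 2 * ((scale R n i - scale R n j) * (scale R n k - scale R n j))
  + \sum_(l < n)
      ((1 - scale R n i ^+ 2) * (-1) ^+ (l \in cube_vertex n i)
       - (1 - scale R n j ^+ 2) * (-1) ^+ (l \in cube_vertex n j)) *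
      ((1 - scale R n k ^+ 2) * (-1) ^+ (l \in cube_vertex n k)
       - (1 - scale R n j ^+ 2) * (-1) ^+ (l \in cube_vertex n j)).
Proof.
rewrite /dotp big_ord_recl !mxE unlift_none; congr (_ + _); first by ring.
by apply: eq_bigr => l _; rewrite !mxE liftK.
Qed.

Lemma sqr_scale_itv (R : realType) (n k : nat) : 0 <= scale R n k ^+ 2 <= 1.
Proof.
have := scale_gt0 R n k; have := scale_le1 R n k.
by move=> h0 h1; apply/andP; split; nra.
Qed.

Lemma sqr_scale_le (R : realType) (n j k : nat) :
  (j <= k)%N -> scale R n k ^+ 2 <= scale R n j ^+ 2.
Proof.
move=> jk; have /andP[d0 d1] := scale_ratio R n.
rewrite lerXn2r ?nnegrE ?(ltW (scale_gt0 _ _ _)) //.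
by apply: ler_wiXn2l => //; lra.
Qed.

Lemma sqr_scale_le_half (R : realType) (n k : nat) :
  (0 < k)%N -> scale R n k ^+ 2 <= 2^-1.
Proof.
move=> /(scale_le_half R n); rewrite [leRHS]/scale expr0.
by have := scale_gt0 R n k; move: (scale R n k) => x; nra.
Qed.

(** Here [a], [b], [c] are [t_i], [t_j], [t_k], [A] is a coordinate separating [s_i] from [s_j], and
    [S] is the sum of the others. The lift costs at most [c^2 / 2] and [S] at most [c^2 / 16], while
    [A] gains at least [3 c^2 / 4]. *)
Lemma between_gt0 (R : realFieldType) (a b c h N A S : R) :
  0 < a -> 0 < b -> 0 < c -> 2 * a <= b -> 2 * b <= c -> 3 <= h ->
  c ^+ 2 - b ^+ 2 <= A -> - (2 * N * b ^+ 2) <= S ->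
  8 * N < h ^+ 2 -> 2 * h ^+ 2 * b <= c ->
  0 < h ^+ 2 * ((a - b) * (c - b)) + (A + S).
Proof.
move=> a0 b0 c0 ab bc h3 gA gS hN hb.
have h0 : 0 <= h ^+ 2 by apply: sqr_ge0.
have e1 : - (h ^+ 2 * (b * c)) <= h ^+ 2 * ((a - b) * (c - b)).
  by rewrite -mulrN; apply: ler_wpM2l => //; nra.
have e2 : h ^+ 2 * (b * c) <= c ^+ 2 / 2.
  have : (2 * h ^+ 2 * b) * c <= c * c by apply: ler_wpM2r => //; apply: ltW.
  lra.
have b2 : 0 <= b ^+ 2 by apply: sqr_ge0.
have e3 : 8 * N * b ^+ 2 <= h ^+ 2 * b ^+ 2.
  by apply: ler_wpM2r => //; apply: ltW.
have e4 : h ^+ 2 * b ^+ 2 <= h ^+ 2 * (b * c) / 2.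
  by rewrite -mulrA; apply: ler_wpM2l => //; nra.
have e5 : b ^+ 2 <= c ^+ 2 / 4 by nra.
have e6 : 0 < c ^+ 2 by apply: exprn_gt0.
lra.
Qed.

Lemma dotp_acute_point_extreme (R : realType) (n i j k : nat) :
  (i < j)%N && (k < j)%N || (j < i)%N && (j < k)%N ->
  0 < dotp (acute_point R n i - acute_point R n j)
           (acute_point R n k - acute_point R n j).
Proof.
move=> ijk; rewrite dotp_acute_point.
have ge_sum : - (2 * n%:R * scale R n j ^+ 2) <= \sum_(l < n)
      ((1 - scale R n i ^+ 2) * (-1) ^+ (l \in cube_vertex n i)
       - (1 - scale R n j ^+ 2) * (-1) ^+ (l \in cube_vertex n j)) *
      ((1 - scale R n k ^+ 2) * (-1) ^+ (l \in cube_vertex n k)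
       - (1 - scale R n j ^+ 2) * (-1) ^+ (l \in cube_vertex n j)).
  apply: sum_ge_card => [|m]; first exact: sqr_ge0.
  by apply: coord_ge; apply: sqr_scale_itv.
(* Both differences [t_i - t_j] and [t_k - t_j] have the same sign and absolute value at least
   [t_j / 2], hence the 1/4. *)
apply: (@lt_le_trans _ _ (height R n ^+ 2 * (scale R n j ^+ 2 / 4)
                          - 2 * n%:R * scale R n j ^+ 2)).
  rewrite [ltRHS](_ : _ =
    scale R n j ^+ 2 * (height R n ^+ 2 - 8 * n%:R) / 4); last by field.
  apply: divr_gt0 => //; apply: mulr_gt0; first exact/exprn_gt0/scale_gt0.
  by rewrite subr_gt0 height_sqr_gt.
apply: lerD => //; apply: ler_wpM2l; first exact: sqr_ge0.
have si := scale_gt0 R n i; have sj := scale_gt0 R n j.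
have sk := scale_gt0 R n k.
case/orP: ijk => /andP[/(scale_le_half R n) h1 /(scale_le_half R n) h2]; nra.
Qed.

Lemma dotp_acute_point_between (R : realType) (n i j k : nat) :
  (k < j)%N -> (j < i)%N -> (i <= 2 ^ n)%N ->
  0 < dotp (acute_point R n i - acute_point R n j)
           (acute_point R n k - acute_point R n j).
Proof.
move=> kj ji i2n.
(* So [i] and [j] index genuine cube vertices. Only [k] can be the apex, and its sign vector is
   irrelevant to the choice of [l]. *)
have jgt0 : (0 < j)%N by apply: leq_ltn_trans kj.
have [l jil] : exists l : 'I_n,
    (l \in cube_vertex n i) != (l \in cube_vertex n j).
  apply/existsP; rewrite -negb_forall; apply/negP => /forallP e.
  have /eqP := cube_vertex_neq jgt0 ji i2n; apply.
  by apply/setP => l; apply/esym/eqP; apply: e.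
rewrite dotp_acute_point (bigD1 l) //=.
have si := scale_gt0 R n i; have sj := scale_gt0 R n j.
have sk := scale_gt0 R n k.
have hji := scale_le_half R n ji; have hkj := scale_le_half R n kj.
have ge_l : scale R n k ^+ 2 - scale R n j ^+ 2 <= _ :=
  @coord_neq_ge R (scale R n i ^+ 2) _ _ _ _ (l \in cube_vertex n k)
    (sqr_ge0 _) (sqr_scale_le R n (ltnW ji)) (sqr_scale_le R n (ltnW kj))
    (proj2 (andP (sqr_scale_itv R n k))) (sqr_scale_le_half R n jgt0) jil.
set S := \sum_(_ < n | _) _.
have ge_S : - (2 * n%:R * scale R n j ^+ 2) <= S.
  apply: sum_ge_card => [|m]; first exact: sqr_ge0.
  by apply: coord_ge; apply: sqr_scale_itv.
apply: (between_gt0 _ _ _ _ _ _ ge_l ge_S) => //; first exact: height_ge3.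
- exact: height_sqr_gt.
- exact: scale_le.
Qed.

Lemma acute_point_angle (R : realType) (n i j k : nat) :
  (i <= 2 ^ n)%N -> (k <= 2 ^ n)%N -> i != j -> k != j ->
  angle (acute_point R n i) (acute_point R n j) (acute_point R n k) < pi / 2.
Proof.
move=> i2n k2n; rewrite !neq_ltn => ij kj; apply: angle_lt_pihalf.
case/orP: ij => ij; case/orP: kj => kj.
- by apply: dotp_acute_point_extreme; rewrite ij kj.
- by rewrite dotpC; apply: dotp_acute_point_between.
- by apply: dotp_acute_point_between.
- by apply: dotp_acute_point_extreme; rewrite ij kj orbT.
Qed.

Theorem theorem1 (R : realType) (d : nat) (hd : (1 <= d)%N) :
  exists p : 'I_(2 ^ (d - 1) + 1)%N -> 'rV[R]_d,
    injective p /\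
    (forall i j k : 'I_(2 ^ (d - 1) + 1)%N,
       i != j -> j != k -> i != k -> acute_triangle (p i) (p j) (p k)).
Proof.
case: d hd => // n _; rewrite subn1 addn1 /=.
exists (fun i => acute_point R n i); split.
  by move=> i j /acute_point_inj/val_inj.
move=> i j k ij jk ik; have le (l : 'I_(2 ^ n).+1) : (l <= 2 ^ n)%N.
  by rewrite -ltnS.
by split; apply: acute_point_angle => //; rewrite eq_sym.
Qed.
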